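(* Let $t_g$ be a gauged stable ribbon tree of arity $n\geqslant 2$ whose gauge intersects exactly $j$ vertices, with underlying stable ribbon tree $t$ and orientation $\omega=e_1\wedge\cdots\wedge e_i$; write $e_0$ for the outgoing edge of $t$. Consider the (above-break) boundary component of $\overline{\mathcal{CT}}_n(t_g)$ corresponding to the breaking of the $p$-th edge $e_p$ of $t$, where either $p\geqslant1$ and $e_p$ is an internal edge located above the gauge or intersecting the gauge, or $p=0$, the gauge lies below the root, and the outgoing edge breaks between the gauge and the root. Let $(t_p)_g$ be the resulting broken gauged tree, with orientation $\omega_p=e_1\wedge\cdots\wedge\widehat{e_p}\wedge\cdots\wedge e_i$ ($\omega_0=\omega$). Then $\mathcal{CT}_n((t_p)_g,\omega_p)$ bears a $(-1)^{p+j}$ sign in the boundary of $\overline{\mathcal{CT}}_n(t_g,\omega)$.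
   Context: A ribbon tree is a planar rooted tree with one outgoing external edge, whose adjacent vertex is the root $r$, and $n$ incoming external edges ordered from left to right; it is stable if all vertices are at least trivalent. $E(t)$ is its set of internal edges, $e(t)=|E(t)|$. An orientation is an ordering of the (finite, i.e. non-broken) internal edges up to even permutation. A gauged stable ribbon tree $t_g$ is a stable ribbon tree $t$ with a partition of its vertices into vertices below the gauge (between gauge and outgoing edge), on the gauge, and above the gauge, such that the parent (next vertex towards $r$) of any vertex below or on the gauge is below the gauge. ''The gauge lies below the root'' means all vertices are above the gauge, which then crosses the outgoing edge. An edge intersects the gauge if its lower end is below and its upper end above the gauge; an internal edge is located above the gauge if its lower end is on or above the gauge. The trivial gauged tree is the arity 1 tree consisting of a single edge crossed by a gauge. $\mathcal{CT}_n(t_g)$ is the polyhedral cone of $(\lambda,(l_e)_{e\in E(t)})\in\mathbb R\times\,]0,+\infty[^{e(t)}$ with $-\lambda>d(r,v)$ for $v$ below, $-\lambda=d(r,v)$ for $v$ on, $-\lambda<d(r,v)$ for $v$ above the gauge ($d(r,v)$ = sum of the lengths on the path from $r$ to $v$). The broken gauged tree $(t_p)_g$: for $p\geqslant1$ it consists of the subtree above $e_p$ (without gauge) grafted, through a broken edge, onto the gauged tree formed by the rest of $t_g$; for $p=0$ it consists of $t$ (without gauge) grafted through a broken edge onto the trivial gauged tree. Its stratum is the set of $(\lambda,(l_e))$ (lengths of all finite internal edges) satisfying the (in)equalities of the gauged piece; for $p=0$ there is no coordinate $\lambda$. Orientations: $\omega$ orients such a stratum, giving $\mathcal{CT}_n(\cdot,\omega)$: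 if no vertex is on the gauge, as an open subset of the space of coordinates ($\lambda$ first if present, then the lengths ordered by $\omega$); in general, with $v_1,\dots,v_j$ the vertices on the gauge from left to right and $\nu_k$ outward-pointing for the half-space $-\lambda\geqslant d(r,v_k)$ (e.g. the gradient of $\lambda+d(r,v_k)$, $r$ the root of the gauged piece), it is cooriented by $(\nu_1,\dots,\nu_j)$ (coorientation followed by orientation is positive). Compactification: let $t_c$ be obtained by colouring the vertices on the gauge and adding a coloured vertex at each intersection of the gauge with the interior of an edge; points of $\mathcal{CT}_n(t_g)$ are lengths of the internal edges of $t_c$ such that all paths from coloured vertices to $r$ have equal length; $\overline{\mathcal{CT}}_n(t_g)$ is obtained by letting these lengths go to $0$ (collapse) or $+\infty$ (break) subject to these equalities. An above-break at an edge intersecting the gauge means that its part above the gauge becomes infinite. A codimension one stratum with a given orientation bears the sign $\varepsilon$ in the boundary if the boundary orientation (outward-pointing vector first) is $\varepsilon$ times the given one. *)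

(* Defs.v *)
(* MathComp + MathComp-Analysis *)
From HB Require Import structures.
From mathcomp Require Import all_boot all_order all_algebra.
From mathcomp Require Import all_classical all_reals all_analysis.

Set Implicit Arguments.
Unset Strict Implicit.
Unset Printing Implicit Defensive.

Import Order.TTheory GRing.Theory Num.Theory.
Import numFieldNormedType.Exports.

Local Open Scope classical_set_scope.
Local Open Scope ring_scope.

(** * Ribbon trees *)

(* [RLeaf] is an incoming external edge; the children of a vertex are listed
   from left to right. The tree [RLeaf] is the single edge without vertices. *)
Inductive rtree := RLeaf | RNode of seq rtree.

(* A vertex, or the upper end of an edge, is located by the list of child
   indices on the path from the root. An edge is named by its upper end, so
   that [::] names both the root vertex and the outgoing edge. *)
Definition addr := seq nat.

Definition parent (a : addr) : addr := take (size a).-1 a.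

Definition graft_addrs (ss : seq (seq addr)) : seq addr :=
  [seq k :: a | k <- iota 0 (size ss), a <- nth [::] ss k].

(* Depth-first, left to right: vertices none of which is an ancestor of another
   one are listed from left to right. *)
Fixpoint vertices (t : rtree) : seq addr :=
  if t is RNode s then [::] :: graft_addrs (map vertices s) else [::].

Fixpoint leaves (t : rtree) : seq addr :=
  if t is RNode s then graft_addrs (map leaves s) else [:: [::]].

Definition internal_edges (t : rtree) : seq addr :=
  [seq a <- vertices t | a != [::]].

Definition arity (t : rtree) : nat := size (leaves t).

(* The valence of a vertex is its number of children plus one. *)
Fixpoint stable (t : rtree) : bool :=
  if t is RNode s then (1 < size s)%N && all stable s else true.

Definition is_orientation (t : rtree) (w : seq addr) : bool :=
  perm_eq w (internal_edges t).

Fixpoint subtree_above (t : rtree) (a : addr) : rtree :=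
  match a, t with
  | [::], _ => t
  | k :: a', RNode s => subtree_above (nth RLeaf s k) a'
  | _ :: _, RLeaf => RLeaf
  end.

Fixpoint prune (t : rtree) (a : addr) : rtree :=
  match a, t with
  | [::], _ => RLeaf
  | k :: a', RNode s => RNode (set_nth RLeaf s k (prune (nth RLeaf s k) a'))
  | _ :: _, RLeaf => RLeaf
  end.

(** * Gauges *)

Inductive gauge_pos := Below | On | Above.

Definition gauge_pos_code (g : gauge_pos) : nat :=
  match g with Below => 0 | On => 1 | Above => 2 end.
Definition gauge_pos_decode (k : nat) : gauge_pos :=
  match k with 0 => Below | 1 => On | _ => Above end.
Lemma gauge_pos_codeK : cancel gauge_pos_code gauge_pos_decode.
Proof. by case. Qed.
HB.instance Definition _ := Equality.copy gauge_pos (can_type gauge_pos_codeK).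

(* Only the values of [g] on [vertices t] are meaningful. *)
Definition is_gauge (t : rtree) (g : addr -> gauge_pos) : Prop :=
  forall v, v \in vertices t -> v != [::] -> g v != Above ->
    g (parent v) = Below.

Definition on_vertices (t : rtree) (g : addr -> gauge_pos) : seq addr :=
  [seq v <- vertices t | g v == On].

Definition gauge_below_root (t : rtree) (g : addr -> gauge_pos) : Prop :=
  forall v, v \in vertices t -> g v = Above.

(* The free end of the outgoing edge is always below the gauge, those of the
   incoming edges always above. *)
Definition lower_pos (g : addr -> gauge_pos) (e : addr) : gauge_pos :=
  if e == [::] then Below else g (parent e).
Definition upper_pos (t : rtree) (g : addr -> gauge_pos) (e : addr) :
    gauge_pos :=
  if e \in vertices t then g e else Above.

Definition crosses (t : rtree) (g : addr -> gauge_pos) (e : addr) : bool :=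
  (lower_pos g e == Below) && (upper_pos t g e == Above).

Definition edge_above_gauge (g : addr -> gauge_pos) (e : addr) : bool :=
  (lower_pos g e == On) || (lower_pos g e == Above).

(** * Internal edges of the coloured tree t_c *)

(* A crossed edge is cut by a coloured vertex in a lower and an upper part. *)
Inductive edge_part := Whole | LowerPart | UpperPart.

Definition edge_part_code (q : edge_part) : nat :=
  match q with Whole => 0 | LowerPart => 1 | UpperPart => 2 end.
Definition edge_part_decode (k : nat) : edge_part :=
  match k with 0 => Whole | 1 => LowerPart | _ => UpperPart end.
Lemma edge_part_codeK : cancel edge_part_code edge_part_decode.
Proof. by case. Qed.
HB.instance Definition _ := Equality.copy edge_part (can_type edge_part_codeK).

(* The lower part of a crossed incoming edge and the upper part of a crossed
   outgoing edge are internal in t_c (the list is meant for trees with at least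
   one vertex). *)
Definition tc_edges (t : rtree) (g : addr -> gauge_pos) :
    seq (addr * edge_part) :=
  [seq (e, Whole) | e <- internal_edges t & ~~ crosses t g e] ++
  [seq (e, LowerPart) | e <- internal_edges t ++ leaves t & crosses t g e] ++
  [seq (e, UpperPart) | e <- vertices t & crosses t g e].

Definition tc_edge (t : rtree) (g : addr -> gauge_pos) : Type :=
  {f : addr * edge_part | f \in tc_edges t g}.

(** * Oriented strata *)

(* A relatively open polyhedral cell in R^N, cooriented by [oc_coor]. *)
Record oriented_cell (R : realType) := OrientedCell {
  oc_dim : nat;
  oc_set : set 'rV[R]_oc_dim;
  oc_coor : seq 'rV[R]_oc_dim }.
Arguments oc_set {R} _.
Arguments oc_coor {R} _.

Section Cells.
Variable R : realType.
Implicit Types M S : oriented_cell R.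

Definition det_rows (N : nat) (s : seq 'rV[R]_N) : R :=
  \det (\matrix_(k < N) nth 0 s k).

Definition tangent M (x w : 'rV[R]_(oc_dim M)) : Prop :=
  \forall e \near (0 : R), oc_set M (x + e *: w).

(* [oc_coor M] spans a complement of the tangent space. *)
Definition tangent_basis M (x : 'rV[R]_(oc_dim M))
    (B : seq 'rV[R]_(oc_dim M)) : Prop :=
  [/\ forall b, b \in B -> tangent x b,
      size (oc_coor M ++ B) = oc_dim M
    & det_rows (oc_coor M ++ B) != 0].

(* Coorientation followed by orientation is positive. *)
Definition basis_sign M (B : seq 'rV[R]_(oc_dim M)) : R :=
  Num.sg (det_rows (oc_coor M ++ B)).

(* The half-open cylinder ]A, +oo] x (S n U). *)
Definition cylinder S (U : set 'rV[R]_(oc_dim S)) (A : R) :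
    set (\bar R * 'rV[R]_(oc_dim S)) :=
  [set sz | [/\ (A%:E < sz.1)%E, oc_set S sz.2 & U sz.2]].

Definition collar_map (X : topologicalType) M S
    (iM : 'rV[R]_(oc_dim M) -> X) (iS : 'rV[R]_(oc_dim S) -> X)
    (Phi : R * 'rV[R]_(oc_dim S) -> 'rV[R]_(oc_dim M))
    (sz : \bar R * 'rV[R]_(oc_dim S)) : X :=
  if sz.1 is (s%:E)%E then iM (Phi (s, sz.2)) else iS sz.2.

(* [M] and [S] are mapped to a space X by [iM] and [iS]; [iM] identifies [M]
   with the interior of its compactification, the closure of its image. Around
   each of its points, [S] is required to have a collar in this closure: a
   homeomorphism from ]A, +oo] x (S n U) to a relatively open subset, equal to
   [iS] on {+oo} x (S n U) and to a differentiable map Phi into [M] elsewhere.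
   The outward-pointing vector of the collar is the derivative of Phi in the
   direction (1, 0), and the boundary orientation (outward-pointing vector
   first) is [eps] times the orientation of [S]. *)
Definition bears_boundary_sign (X : topologicalType) M S
    (iM : 'rV[R]_(oc_dim M) -> X) (iS : 'rV[R]_(oc_dim S) -> X) (eps : R) :
    Prop :=
  forall y, oc_set S y ->
  exists (U : set 'rV[R]_(oc_dim S)) (A : R)
    (Phi : R * 'rV[R]_(oc_dim S) -> 'rV[R]_(oc_dim M)),
    let D := cylinder U A in
    let Psi := collar_map iM iS Phi in
    [/\ nbhs y U,
        [/\ {within D, continuous Psi},
            set_inj D Psi
          & forall O, open O -> exists2 O' : set X, open O' &
              Psi @` (D `&` O) = closure (iM @` oc_set M) `&` O']
      & forall (s : R) z, D (s%:E, z) ->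
        [/\ oc_set M (Phi (s, z)),
            differentiable Phi (s, z)
          & forall B, tangent_basis z B ->
            let B' := 'd Phi (s, z) (1, 0) ::
                      [seq 'd Phi (s, z) (0, b) | b <- B] in
            tangent_basis (Phi (s, z)) B' /\
            basis_sign B' = eps * basis_sign B]].

(** * Coordinates *)

(* The coordinate list [cs] orders the coordinates: [None] names lambda and
   [Some e] the length of the edge [e]. [coord] is 0 on absent names. *)
Definition coord (cs : seq (option addr)) (x : 'rV[R]_(size cs))
    (c : option addr) : R :=
  \sum_(k < size cs | nth None cs k == c) x ord0 k.

Definition root_dist (cs : seq (option addr)) (x : 'rV[R]_(size cs))
    (v : addr) : R :=
  \sum_(k < size v) coord x (Some (take k.+1 v)).

(* Gradient of the linear form lambda + d(r, v). *)
Definition gauge_gradient (cs : seq (option addr)) (v : addr) :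
    'rV[R]_(size cs) :=
  \row_k (coord (delta_mx 0 k) None + root_dist (delta_mx 0 k) v).

(* [h] is the height - lambda of the gauge. *)
Definition gauge_ineq (q : gauge_pos) (h d : R) : Prop :=
  match q with Below => d < h | On => h = d | Above => h < d end.

(* The trivial gauged tree has no coordinate lambda. *)
Definition coords (t : rtree) (w : seq addr) : seq (option addr) :=
  if t is RNode _ then None :: map Some w else map Some w.

(* Stratum with gauged piece [t] and finite internal edges [E], ordered by [w]. *)
Definition stratum (t : rtree) (g : addr -> gauge_pos) (E w : seq addr) :
    oriented_cell R :=
  let cs := coords t w in
  OrientedCell
    [set x : 'rV[R]_(size cs) |
      (forall e, e \in E -> 0 < coord x (Some e)) /\
      (forall v, v \in vertices t ->
         gauge_ineq (g v) (- coord x None) (root_dist x v))]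
    [seq gauge_gradient cs v | v <- on_vertices t g].

Definition CT (t : rtree) (g : addr -> gauge_pos) (w : seq addr) :
    oriented_cell R :=
  stratum t g (internal_edges t) w.

(* Breaking [a]: [subtree_above t a] is grafted on [prune t a] at the leaf [a].
   Edges keep the names that they have in [t]; for a = [::] the gauged piece is
   the trivial gauged tree. *)
Definition broken_edges (t : rtree) (a : addr) : seq addr :=
  internal_edges (prune t a) ++
  [seq a ++ b | b <- internal_edges (subtree_above t a)].

Definition CT_broken (t : rtree) (g : addr -> gauge_pos) (a : addr)
    (w : seq addr) : oriented_cell R :=
  stratum (prune t a) g (broken_edges t a) w.

(** * Compactification *)

(* Coloured vertices are at distance - lambda from the root (for the one on the
   outgoing edge, at height - lambda < 0). *)
Definition tc_length (cs : seq (option addr)) (x : 'rV[R]_(size cs))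
    (f : addr * edge_part) : R :=
  match f.2 with
  | Whole => coord x (Some f.1)
  | LowerPart => - coord x None - root_dist x (parent f.1)
  | UpperPart => root_dist x f.1 - (- coord x None)
  end.

Definition tc_space (t : rtree) (g : addr -> gauge_pos) : topologicalType :=
  {ptws tc_edge t g -> \bar R}.

Definition CT_emb (t : rtree) (g : addr -> gauge_pos) (w : seq addr)
    (x : 'rV[R]_(oc_dim (CT t g w))) : tc_space t g :=
  fun f => (@tc_length (coords t w) x (sval f))%:E.

(* Above-break at [a]: the whole edge becomes infinite if it is above the gauge,
   its upper part if it crosses the gauge. *)
Definition above_break_part (t : rtree) (g : addr -> gauge_pos) (a : addr) :
    addr * edge_part :=
  (a, if crosses t g a then UpperPart else Whole).

Definition CT_broken_emb (t : rtree) (g : addr -> gauge_pos) (a : addr)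
    (w : seq addr) (y : 'rV[R]_(oc_dim (CT_broken t g a w))) : tc_space t g :=
  fun f => if sval f == above_break_part t g a then +oo%E
           else (@tc_length (coords (prune t a) w) y (sval f))%:E.

End Cells.

Arguments CT R t g w : clear implicits.
Arguments CT_broken R t g a w : clear implicits.
Arguments CT_emb R t g w x : clear implicits.
Arguments CT_broken_emb R t g a w y : clear implicits.

(* e_p, with e_0 the outgoing edge. *)
Definition nth_edge (w : seq addr) (p : nat) : addr := nth [::] ([::] :: w) p.

(* Main.v *)
Require Import Defs.
From HB Require Import structures.
From mathcomp Require Import all_boot all_order all_algebra.
From mathcomp Require Import all_classical all_reals all_analysis.
From mathcomp Require Import ring lra zify.

Set Implicit Arguments.
Unset Strict Implicit.
Unset Printing Implicit Defensive.

Import Defs Order.TTheory GRing.Theory Num.Theory.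
Import numFieldNormedType.Exports.

Local Open Scope classical_set_scope.
Local Open Scope ring_scope.

(* Let s be the length of the part of t_c that breaks. Near the broken stratum,
   the coordinates of CT_n(t_g) other than the broken one (l_(e_p), or lambda
   when p = 0) stay finite, and the broken one is s plus a linear form in them.
   The collar is therefore the linear map that inserts this coordinate at
   position p; its outward-pointing vector is the p-th basis vector. Nothing
   below or on the gauge lies above e_p, so the j gauge gradients do not involve
   the inserted coordinate. Expanding the determinant along the row of the
   outward-pointing vector, which comes after the j coorienting rows and has
   its only entry in column p, gives the sign (-1)^(p + j). The inverse of the
   collar is continuous because every remaining coordinate is a combination of
   finite lengths in t_c, lambda being read off at any coloured vertex. *)

(** * Pointwise convergence *)

(** The pointwise topology is the supremum of the topologies induced by the evaluations, so
    convergence may be tested on each of them. *)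
Lemma cvg_prodP (I : Type) (T : topologicalType) (F : set_system {ptws I -> T})
    (g : {ptws I -> T}) : Filter F ->
  F --> g <-> forall i, (fun h : {ptws I -> T} => h i) @ F --> g i.
Proof.
move=> FF; split=> [Fg i|Fg].
  apply: cvg_trans (cvg_app _ Fg) _.
  exact: (@proj_continuous {classic I} (fun=> T) i g).
apply/cvg_sup => i; apply/cvg_image => //.
  (* Constant functions make every evaluation surjective. *)
  by rewrite eqEsubset; split=> // y _; exists (fun=> y).
move=> B /(Fg i) FB; exists ((fun h : {ptws I -> T} => h i) @^-1` B) => //.
by apply: image_preimage; rewrite eqEsubset; split=> // y _; exists (fun=> y).
Qed.

Lemma ptws_continuous_eval (I : Type) (T : topologicalType) (i : I) :
  continuous (fun h : {ptws I -> T} => h i).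
Proof. by move=> g; have /cvg_prodP := @cvg_id _ (nbhs g); apply. Qed.

Lemma ptws_cvgP (U : topologicalType) (I : Type) (T : topologicalType)
    (F : set_system U) (h : U -> {ptws I -> T}) (g : {ptws I -> T}) :
  Filter F ->
  h @ F --> g <-> forall i, (fun u => h u i) @ F --> g i.
Proof. by move=> FF; rewrite cvg_prodP. Qed.

Lemma cvg_row (R : realType) (T : Type) (F : set_system T) n
    (h : T -> 'I_n -> R) (l : 'I_n -> R) : Filter F ->
  (forall k, h x k @[x --> F] --> l k) ->
  (\row_k h x k : 'rV[R]_n) @[x --> F] --> (\row_k l k : 'rV[R]_n).
Proof.
move=> FF hl; apply/cvg_ballP => e e0.
have : \forall x \near F, forall k, ball (l k) e (h x k).
  by apply: filter_forall => k; move: e e0; apply/cvg_ballP/hl.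
apply: filterS => x hx; split=> // i k; rewrite !mxE; exact: hx.
Qed.

(** Carries equations from the open cell to its closure. Continuity is asked only at [x] because
    [fine] will occur in [h], and it is not continuous at infinite values. *)
Lemma closure_eq0_continuous (R : realType) (X : topologicalType) (A : set X)
    (h : X -> R) (x : X) :
  closure A x -> {for x, continuous h} -> (forall y, A y -> h y = 0) -> h x = 0.
Proof.
move=> clAx ch hA0; apply/eqP/negPn/negP => hx0.
have /ch /clAx [y [/hA0 + /=]] : nbhs (h x) [set r | r != 0].
  by apply: open_nbhs_nbhs; split => //; exact: open_neq.
by move=> ->; rewrite eqxx.
Qed.

Lemma EFin_continuous (R : realType) : continuous (@EFin R).
Proof. by move=> x; apply/fine_cvgP; split; [exact: nearW|exact: cvg_id]. Qed.

(** A finite intersection, by induction on [s]. Quantifying over membership proofs in [Q] gives a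
    meaning to the condition at points outside [s]. *)
Lemma filter_forall_sig (T : eqType) (s : seq T) (Y : Type)
    (F : set_system Y) (P : {x | x \in s} -> set Y) : Filter F ->
  (forall x, F (P x)) -> F [set y | forall x, P x y].
Proof.
move=> FF FP; pose Q x := [set y | forall xs : x \in s, P (exist _ x xs) y].
have FQ (r : seq T) : F [set y | forall x, x \in r -> Q x y].
  elim: r => [|x r IHr]; first by apply: filterS filterT => y _ x.
  have FQx : F (Q x).
    case: (boolP (x \in s)) => [xs|/negP xs]; last first.
      by apply: filterS filterT => y _ xs'; case: xs.
    apply: filterS (FP (exist _ x xs)) => y Pxy xs'.
    by rewrite (bool_irrelevance xs' xs).
  by apply: filterS2 IHr FQx => y Qr Qx x'; rewrite inE => /predU1P[->|/Qr].
by apply: filterS (FQ s) => y Qy [x xs]; exact: Qy.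
Qed.

(** Laplace expansion along row [j], whose only nonzero entry is in column [p]; the remaining minor
    is the matrix of [v]. Other entries of column [p] are deleted, hence unconstrained. *)
Lemma det_rows_insert (R : realType) (N n : nat) (u : seq 'rV[R]_N)
    (v : seq 'rV[R]_n) (j p : nat) :
  N = n.+1 -> (j <= n)%N -> (p <= n)%N ->
  (forall i : 'I_N, (nth 0 u j) ord0 i = ((i : nat) == p)%:R) ->
  (forall k (i : 'I_N) (i' : 'I_n), (k < n)%N -> i = bump p i' :> nat ->
     (nth 0 u (bump j k)) ord0 i = (nth 0 v k) ord0 i') ->
  det_rows u = (-1) ^+ (j + p) * det_rows v.
Proof.
move=> eN jn pn uj uv; subst N.
have jn' : (j < n.+1)%N by [].
have pn' : (p < n.+1)%N by [].
rewrite /det_rows (expand_det_row _ (Ordinal jn')) (bigD1 (Ordinal pn')) //=.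
rewrite big1 ?addr0 => [|i ip]; last first.
  have /negPf ip' : (i : nat) != p by [].
  by rewrite !mxE uj ip' mul0r.
rewrite !mxE uj eqxx mul1r /cofactor; congr (_ * \det _).
by apply/matrixP => k i; rewrite !mxE; apply: uv.
Qed.

(** * Coordinate functions *)

Section CoordinateFunctions.
Variable R : realType.
Implicit Types (c : option addr -> R) (v : addr) (f : addr * edge_part).

(* [root_dist] and [tc_length] for a coordinate function indexed by names, which
   makes points of strata with different coordinate lists comparable. *)
Definition dist_of c v : R := \sum_(k < size v) c (Some (take k.+1 v)).

Definition length_of c f : R :=
  match f.2 with
  | Whole => c (Some f.1)
  | LowerPart => - c None - dist_of c (parent f.1)
  | UpperPart => dist_of c f.1 - (- c None)
  end.

(** The linear form with gradient [gauge_gradient]; its zero set is the condition that [v] is on the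
    gauge. *)
Definition gauge_of c v : R := c None + dist_of c v.

Lemma dist_of_linear (k : R) c c' v :
  dist_of (fun m => k * c m + c' m) v = k * dist_of c v + dist_of c' v.
Proof. by rewrite /dist_of big_split -mulr_sumr. Qed.

Lemma eq_dist_of c c' v :
  (forall k, (k < size v)%N -> c (Some (take k.+1 v)) = c' (Some (take k.+1 v))) ->
  dist_of c v = dist_of c' v.
Proof. by move=> cc'; apply: eq_bigr => k _; apply: cc'. Qed.

Section Limits.
Variables (T : Type) (F : set_system T) (FF : Filter F).
Variables (h : T -> option addr -> R) (c : option addr -> R).
Hypothesis hc : forall m, h x m @[x --> F] --> c m.

Lemma cvg_dist_of v : dist_of (h x) v @[x --> F] --> dist_of c v.
Proof.
apply: cvg_big => [|k _]; last exact: hc.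
exact: add_continuous.
Qed.

Lemma cvg_length_of f : length_of (h x) f @[x --> F] --> length_of c f.
Proof.
case: f => e [] /=; first exact: hc.
- by apply: cvgB; [apply: cvgN; exact: hc|exact: cvg_dist_of].
- by apply: cvgB; [exact: cvg_dist_of|apply: cvgN; exact: hc].
Qed.

Lemma cvg_gauge_of v : gauge_of (h x) v @[x --> F] --> gauge_of c v.
Proof. by apply: cvgD; [exact: hc|exact: cvg_dist_of]. Qed.

End Limits.

Lemma coord_linear (cs : seq (option addr)) (k : R) (x y : 'rV[R]_(size cs)) :
  coord (k *: x + y) = (fun m => k * coord x m + coord y m).
Proof.
apply/funext => m; rewrite /coord mulr_sumr -big_split.
by apply: eq_bigr => i _; rewrite !mxE.
Qed.

Lemma coord_notin (cs : seq (option addr)) (x : 'rV[R]_(size cs)) m :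
  m \notin cs -> coord x m = 0.
Proof.
move=> mcs; apply: big_pred0 => k; apply/negbTE; apply: contraNneq mcs => <-.
exact: mem_nth.
Qed.

Lemma coord_nth (cs : seq (option addr)) (x : 'rV[R]_(size cs))
    (k : 'I_(size cs)) : uniq cs -> coord x (nth None cs k) = x ord0 k.
Proof.
move=> ucs; rewrite /coord (big_pred1 k) // => i.
by rewrite /= nth_uniq.
Qed.

Lemma coord_row (cs : seq (option addr)) (c : option addr -> R) m :
  uniq cs ->
  coord (\row_(k < size cs) c (nth None cs k)) m = if m \in cs then c m else 0.
Proof.
move=> ucs; case: ifPn => [mcs|/coord_notin->//].
have im : (index m cs < size cs)%N by rewrite index_mem.
have -> : m = nth None cs (Ordinal im) by rewrite /= nth_index.
by rewrite coord_nth // mxE.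
Qed.

Lemma coord_delta (cs : seq (option addr)) (k : 'I_(size cs)) m :
  uniq cs ->
  coord (delta_mx ord0 k : 'rV[R]_(size cs)) m = (nth None cs k == m)%:R.
Proof.
move=> ucs; case: (boolP (m \in cs)) => mcs; last first.
  rewrite coord_notin //; case: eqP => // mk.
  by rewrite -mk mem_nth in mcs.
have im : (index m cs < size cs)%N by rewrite index_mem.
have -> : m = nth None cs (Ordinal im) by rewrite /= nth_index.
by rewrite coord_nth // mxE eqxx nth_uniq // eq_sym.
Qed.

Lemma coord_continuous (cs : seq (option addr)) m :
  continuous (fun x : 'rV[R]_(size cs) => coord x m).
Proof.
move=> x; apply: (@cvg_big R _ _ _ _ _ _ (nbhs x)) => [|k _].
  exact: add_continuous.
exact: (@matrix_normedtype.coord_continuous R).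
Qed.

End CoordinateFunctions.

(** * Recovering coordinates from the finite lengths of t_c *)

Section Recovery.
Variables (R : realType) (E : seq (addr * edge_part)) (b : addr * edge_part).
Variable V : seq addr.
Implicit Types (c : option addr -> R) (l : (option addr -> R) -> R).

Local Notation lengths := {ptws {f | f \in E} -> \bar R}.

Definition on_gauge c : Prop := forall v, v \in V -> gauge_of c v = 0.

Definition finite_off (phi : lengths) : Prop :=
  forall f, sval f != b -> phi f \is a fin_num.

Definition lengths_off (phi : lengths) c : Prop :=
  forall f, sval f != b -> phi f = (length_of c (sval f))%:E.

(* The form [l] is a function of the lengths other than that of [b], continuous
   where these are finite. *)
Definition recoverable l : Prop :=
  exists2 h : lengths -> R,
    forall phi, finite_off phi -> h psi @[psi --> phi] --> h phi &
    forall phi c, on_gauge c -> lengths_off phi c -> h phi = l c.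

(** Agreement is needed only where the gauge equalities hold; this is what lets lambda be read off
    at a vertex on the gauge. *)
Lemma eq_recoverable l l' :
  (forall c, on_gauge c -> l c = l' c) -> recoverable l -> recoverable l'.
Proof.
move=> ll' [h ch hl]; exists h => // phi c onc phic.
by rewrite -ll' // (hl _ c).
Qed.

Lemma recoverable0 : recoverable (fun=> 0).
Proof. by exists (fun=> 0) => // phi _; exact: cst_continuous. Qed.

Lemma recoverableN l : recoverable l -> recoverable (fun c => - l c).
Proof.
move=> [h ch hl]; exists (fun phi => - h phi) => [phi fphi|phi c onc phic].
  exact: (cvgN (ch _ fphi)).
by rewrite (hl _ c).
Qed.

Lemma recoverableD l l' :
  recoverable l -> recoverable l' -> recoverable (fun c => l c + l' c).
Proof.
move=> [h ch hl] [h' ch' hl']; exists (fun phi => h phi + h' phi).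
  by move=> phi fphi; exact: (cvgD (ch _ fphi) (ch' _ fphi)).
by move=> phi c onc phic; rewrite (hl _ c) // (hl' _ c).
Qed.

(** The witness is an evaluation followed by [fine], which is continuous at finite values. *)
Lemma recoverable_length f :
  f \in E -> f != b -> recoverable (fun c => length_of c f).
Proof.
move=> fE fb; exists (fun phi => fine (phi (exist _ f fE))).
  move=> phi fphi; pose i : {f | f \in E} := exist _ f fE.
  have ci : psi i @[psi --> phi] --> (fine (phi i))%:E.
    by rewrite fineK ?fphi //; exact: ptws_continuous_eval.
  exact: (@fine_cvg R lengths (nbhs phi) _ (fun psi => psi i) _ ci).
by move=> phi c _ /(_ (exist _ f fE) fb) ->.
Qed.

Lemma recoverable_dist v :
  (forall k, (k < size v)%N -> recoverable (fun c => c (Some (take k.+1 v)))) ->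
  recoverable (fun c => dist_of c v).
Proof.
move=> rv; rewrite /dist_of.
have : forall k, (k <= size v)%N ->
    recoverable (fun c => \sum_(i < k) c (Some (take i.+1 v))).
  elim=> [|k IHk] kv.
    by apply: eq_recoverable recoverable0 => c _; rewrite big_ord0.
  apply: eq_recoverable (recoverableD (IHk (ltnW kv)) (rv k kv)) => c _.
  by rewrite big_ord_recr.
exact.
Qed.

End Recovery.

(** * The collar of an inserted coordinate *)

Section Collar.
Variables (R : realType) (cs cs' : seq (option addr)) (c0 : option addr).
Hypotheses (cs_uniq : uniq cs) (c0_in : c0 \in cs) (cs'E : cs' = rem c0 cs).

Let cs'_uniq : uniq cs'. Proof. by rewrite cs'E rem_uniq. Qed.

Let mem_cs' m : (m \in cs') = (m != c0) && (m \in cs).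
Proof. by rewrite cs'E mem_rem_uniq. Qed.

Let size_cs : size cs = (size cs').+1.
Proof.
by rewrite cs'E size_rem // prednK // -has_predT; apply/hasP; exists c0.
Qed.

Let nth_cs' k : nth None cs' k = nth None cs (bump (index c0 cs) k).
Proof.
have ics : (index c0 cs <= size cs)%N by rewrite ltnW ?index_mem.
rewrite cs'E remE nth_cat size_takel // /bump.
case: ltnP => ks; first by rewrite nth_take.
by rewrite nth_drop addSn subnKC.
Qed.

Variable o : option addr.
Implicit Types c : option addr -> R.

(* The shift makes [s] the length of the broken part of t_c: when this part lies
   on a crossed edge, [v] is the lower end of that edge. *)
Definition shift_of (c : option addr -> R) : R :=
  if o is Some v then - gauge_of c v else 0.

Definition insert_coord (s : R) (c : option addr -> R) : option addr -> R :=
  fun m => if m == c0 then s + shift_of c else c m.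

Definition insert_map (sz : R * 'rV[R]_(size cs')) : 'rV[R]_(size cs) :=
  \row_k insert_coord sz.1 (coord sz.2) (nth None cs k).

Lemma shift_of_linear (k : R) c c' :
  shift_of (fun m => k * c m + c' m) = k * shift_of c + shift_of c'.
Proof.
rewrite /shift_of /gauge_of; case: o => [v|]; last by rewrite mulr0 addr0.
by rewrite dist_of_linear; ring.
Qed.

(** An equality of functions on all names: both sides vanish on names absent from [cs], as [c0] is
    not one of them. *)
Lemma coord_insert_map s z : coord (insert_map (s, z)) = insert_coord s (coord z).
Proof.
apply/funext => m; rewrite coord_row //; case: ifPn => // mcs.
rewrite /insert_coord; case: eqP => [mc0|_]; first by rewrite mc0 c0_in in mcs.
by rewrite coord_notin // mem_cs' (negPf mcs) andbF.
Qed.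

Lemma insert_map_linear : linear insert_map.
Proof.
move=> k [s z] [s' z']; apply/rowP => i; rewrite !mxE /insert_coord /=.
case: eqP => _; last by rewrite coord_linear.
by rewrite coord_linear shift_of_linear mulrDr addrACA.
Qed.
HB.instance Definition _ :=
  GRing.isLinear.Build R (R * 'rV[R]_(size cs'))%type 'rV[R]_(size cs) *:%R
    insert_map insert_map_linear.

Lemma insert_map_continuous : continuous insert_map.
Proof.
move=> [s z]; apply: cvg_row => k; rewrite /insert_coord.
have coz m : coord x.2 m @[x --> nbhs (s, z)] --> coord z m.
  exact: (cvg_comp snd (fun y : 'rV[R]_(size cs') => coord y m) cvg_snd
            (@coord_continuous _ cs' m z)).
case: (nth None cs k =P c0) => _ //; apply: cvgD; first exact: cvg_fst.
rewrite /shift_of; case: o => [v|]; last exact: cvg_cst.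
by apply: cvgN; exact: cvg_gauge_of.
Qed.

(** In the application [E] lists the edges of t_c, [b] is its broken part, [V] the vertices on the
    gauge, and [PM], [PS] are the conditions of the unbroken and broken cells. The hypotheses
    isolate what the collar needs: the inserted coordinate affects neither the lengths other than
    that of [b] nor the gauge equalities. *)
Variables (E : seq (addr * edge_part)) (b : addr * edge_part) (bE : b \in E).
Variables (V : seq addr) (PM PS : (option addr -> R) -> Prop).

Local Notation lengths := {ptws {f | f \in E} -> \bar R}.
Local Notation agree c c' := (forall m, m != c0 -> c m = c' m).

Hypothesis length_local : forall (c c' : option addr -> R) f,
  agree c c' -> f \in E -> f != b ->
  length_of c f = length_of c' f.
Hypothesis length_insert : forall s (c : option addr -> R),
  length_of (insert_coord s c) b = s.
Hypothesis gauge_local : forall (c c' : option addr -> R) v,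
  agree c c' -> v \in V -> gauge_of c v = gauge_of c' v.
Hypothesis PM_on : forall c, PM c -> on_gauge V c.
Hypothesis PM_of_lengths : forall c, on_gauge V c ->
  (forall f, f \in E -> 0 < length_of c f) -> PM c.
Hypothesis PS_lengths : forall c, PS c <->
  on_gauge V c /\ (forall f, f \in E -> f != b -> 0 < length_of c f).
Hypothesis recover : forall m, m \in cs' ->
  recoverable E b V (fun c : option addr -> R => c m).

Let M := OrientedCell [set x : 'rV[R]_(size cs) | PM (coord x)]
  [seq gauge_gradient R cs v | v <- V].
Let S := OrientedCell [set z : 'rV[R]_(size cs') | PS (coord z)]
  [seq gauge_gradient R cs' v | v <- V].
Let iM (x : 'rV[R]_(oc_dim M)) : lengths :=
  fun f => (@tc_length R cs x (sval f))%:E.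
Let iS (z : 'rV[R]_(oc_dim S)) : lengths :=
  fun f => if sval f == b then +oo%E else (@tc_length R cs' z (sval f))%:E.

Let insert_agree s c : agree (insert_coord s c) c.
Proof. by move=> m mc0; rewrite /insert_coord (negPf mc0). Qed.

Let on_gauge_local c c' : agree c c' -> on_gauge V c -> on_gauge V c'.
Proof. by move=> cc' onc v vV; rewrite -(gauge_local cc' vV) onc. Qed.

Let PM_insert s c : 0 < s -> PS c -> PM (insert_coord s c).
Proof.
move=> s0 /PS_lengths[onc pos]; apply: PM_of_lengths.
  by apply: on_gauge_local onc => m /insert_agree ->.
move=> f fE; have [->|fb] := eqVneq f b; first by rewrite length_insert.
by rewrite (length_local (@insert_agree s c)) // pos.
Qed.

(** A single formula for the collar at finite and infinite [s], continuous on the whole product. It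
    differs from [collar_map] at [-oo], whence the condition [0 < s] in [collarE]. *)
Definition extended_lengths (s : \bar R) (z : 'rV[R]_(size cs')) : lengths :=
  fun f => if sval f == b then s else (length_of (coord z) (sval f))%:E.

Let iM_insert s z : iM (insert_map (s, z)) = extended_lengths s%:E z.
Proof.
apply/funext => -[f fE]; rewrite /iM /extended_lengths /=.
have -> : tc_length (insert_map (s, z)) f = length_of (insert_coord s (coord z)) f.
  by rewrite -coord_insert_map.
have [->|fb] := eqVneq f b; first by rewrite length_insert.
by rewrite (length_local (@insert_agree s (coord z))).
Qed.

Let collarE s z : (0 < s)%E ->
  collar_map iM iS insert_map (s, z) = extended_lengths s z.
Proof. by case: s => [s||] // _; exact: iM_insert. Qed.

Let extended_lengths_continuous :
  continuous (fun sz : \bar R * 'rV[R]_(size cs') =>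
    extended_lengths sz.1 sz.2).
Proof.
move=> [s z]; apply/ptws_cvgP => -[f fE]; rewrite /extended_lengths /=.
case: (f == b); first exact: cvg_fst.
apply: (@continuous_cvg _ R (\bar R) _ _ _ (@EFin R)).
  exact: EFin_continuous.
apply: cvg_length_of => m.
exact: (cvg_comp snd (fun y : 'rV[R]_(size cs') => coord y m) cvg_snd
          (@coord_continuous _ cs' m z)).
Qed.

Let row_coord (z : 'rV[R]_(size cs')) : \row_k coord z (nth None cs' k) = z.
Proof. by apply/rowP => k; rewrite mxE coord_nth. Qed.

Let extended_lengths_off s z : lengths_off b (extended_lengths s z) (coord z).
Proof. by move=> f /negPf fb; rewrite /extended_lengths fb. Qed.

(** Gathers the recovered coordinates into one map [rho], the second component of the inverse of the
    collar. *)
Let recover_map : exists2 rho : lengths -> 'rV[R]_(size cs'),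
  forall phi, finite_off b phi -> rho psi @[psi --> phi] --> rho phi &
  forall phi c, on_gauge V c -> lengths_off b phi c ->
    rho phi = \row_k c (nth None cs' k).
Proof.
have /choice[h hP] : forall k : 'I_(size cs'), exists h : lengths -> R,
    (forall phi, finite_off b phi -> h psi @[psi --> phi] --> h phi) /\
    (forall phi c, on_gauge V c -> lengths_off b phi c ->
       h phi = c (nth None cs' k)).
  by move=> k; have [h ch hc] := recover (mem_nth None (ltn_ord k)); exists h.
exists (fun phi => \row_k h k phi) => [phi fphi|phi c onc phic].
  have ch k : h k psi @[psi --> phi] --> h k phi by have [+ _] := hP k; exact.
  exact: (@cvg_row R lengths (nbhs phi) _ (fun psi k => h k psi)
            (fun k => h k phi) _ ch).
by apply/rowP => k; rewrite !mxE; have [_ /(_ phi c)->] := hP k.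
Qed.

Let extended_lengths_closure s z : (0 < s)%E -> PS (coord z) ->
  closure (iM @` oc_set M) (extended_lengths s z).
Proof.
move=> s0 Sz.
have fin_image r : 0 < r -> (iM @` oc_set M) (extended_lengths r%:E z).
  move=> r0; exists (insert_map (r, z)); last exact: iM_insert.
  by rewrite /= coord_insert_map; exact: PM_insert.
case: s s0 => [s||] // s0; first by apply: subset_closure; exact: fin_image.
move=> B /(@extended_lengths_continuous (+oo%E, z)).
case=> -[B1 B2] /= [[r [_ rB1]] /nbhs_singleton B2z] sB.
(* A finite length beyond [r], to enter the given neighbourhood of [+oo], and positive, to give a
   point of [M]. *)
exists (extended_lengths (Num.max r 0 + 1)%:E z); split.
  by apply: fin_image; rewrite ltr_wpDl // le_max lexx orbT.
apply: (sB (_, z)); split => //=; apply: rB1.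
by rewrite lte_fin (le_lt_trans (_ : _ <= Num.max r 0)) ?le_max ?lexx // ltrDl.
Qed.

(** On the image of [M] the gauge equalities and the length formulas hold for the coordinates read
    by [rho]. They are equations continuous at [phi], so they persist in the closure. *)
Let closure_lengths (rho : lengths -> 'rV[R]_(size cs')) phi :
  (forall psi c, on_gauge V c -> lengths_off b psi c ->
     rho psi = \row_k c (nth None cs' k)) ->
  rho psi @[psi --> phi] --> rho phi -> finite_off b phi ->
  closure (iM @` oc_set M) phi ->
  on_gauge V (coord (rho phi)) /\ lengths_off b phi (coord (rho phi)).
Proof.
move=> rhoE crho fphi clphi.
have ccoord m : coord (rho psi) m @[psi --> phi] --> coord (rho phi) m.
  exact: (cvg_comp rho (fun y : 'rV[R]_(size cs') => coord y m) crho
            (@coord_continuous _ cs' m (rho phi))).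
(* [rho] forgets the coordinate [c0], so it returns the coordinates of [x] only away from [c0]. *)
have rho_agree x : oc_set M x -> agree (coord (rho (iM x))) (coord x).
  move=> Mx m mc0; rewrite (rhoE _ (coord x)) //; last exact: PM_on.
  by rewrite coord_row // mem_cs' mc0 /=; case: ifPn => // /coord_notin ->.
split=> [v vV|[f fE] /= fb].
  apply: (closure_eq0_continuous
    (h := fun psi => gauge_of (coord (rho psi)) v) clphi).
    exact: (@cvg_gauge_of R lengths (nbhs phi) _ (fun psi => coord (rho psi))
              _ ccoord v).
  move=> _ [x Mx <-]; rewrite (gauge_local (rho_agree x Mx)) //.
  exact: (PM_on Mx).
set i : {f | f \in E} := exist _ f fE.
apply/eqP; rewrite -[phi i]fineK ?fphi // eqe -subr_eq0; apply/eqP.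
pose h (psi : lengths) := fine (psi i) - length_of (coord (rho psi)) f.
apply: (closure_eq0_continuous (h := h) clphi).
  have cl : length_of (coord (rho psi)) f @[psi --> phi] -->
      length_of (coord (rho phi)) f.
    exact: (@cvg_length_of R lengths (nbhs phi) _ (fun psi => coord (rho psi))
              _ ccoord f).
  have ci : psi i @[psi --> phi] --> (fine (phi i))%:E.
    by rewrite fineK ?fphi //; exact: ptws_continuous_eval.
  exact: (cvgB (@fine_cvg R lengths (nbhs phi) _ (fun psi => psi i) _ ci) cl).
move=> _ [x Mx <-]; rewrite /h (length_local (rho_agree x Mx)) //.
exact: subrr.
Qed.

Let insert_map_add s z e (r : R) y :
  insert_map (s, z) + e *: insert_map (r, y) = insert_map (s + e * r, z + e *: y).
Proof.
by rewrite addrC -insert_map_linear; congr (insert_map (_, _)); rewrite addrC.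
Qed.

Let insert_map_tangent s z B : 0 < s -> PS (coord z) ->
  (forall y, y \in B -> @tangent R S z y) ->
  forall x, x \in insert_map (1, 0) :: [seq insert_map (0, y) | y <- B] ->
    @tangent R M (insert_map (s, z)) x.
Proof.
move=> s0 Sz tB x; rewrite inE => /predU1P[->|/mapP[y /tB ty ->]]; rewrite /tangent.
  near=> e; rewrite insert_map_add scaler0 addr0 mulr1 /= coord_insert_map.
  apply: PM_insert => //; rewrite -ltrBlDl sub0r.
  by near: e; apply: lt_nbhsr; rewrite oppr_lt0.
apply: filterS ty => e Sy.
by rewrite insert_map_add mulr0 addr0 /= coord_insert_map; exact: PM_insert.
Unshelve. all: by end_near. Qed.

(** The outward vector is row [size V], after the coorienting rows. The rows coming from [B] may
    carry a shift in column [index c0 cs], but the expansion deletes that column. *)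
Let det_insert (B : seq 'rV[R]_(size cs')) :
  size (oc_coor S ++ B) = size cs' ->
  det_rows (oc_coor M ++ insert_map (1, 0) :: [seq insert_map (0, y) | y <- B]) =
  (-1) ^+ (index c0 cs + size V) * det_rows (oc_coor S ++ B).
Proof.
rewrite size_cat size_map => sB.
rewrite addnC; apply: det_rows_insert.
- exact: size_cs.
- by rewrite /= -sB leq_addr.
- by rewrite -ltnS -size_cs index_mem.
- move=> i; rewrite nth_cat size_map ltnn subnn mxE /insert_coord.
  have -> : coord (0 : 'rV[R]_(size cs')) = fun=> 0.
    by apply/funext => m; apply: big1 => k _; rewrite mxE.
  have -> : (nth None cs i == c0) = ((i : nat) == index c0 cs).
    by rewrite -{1}(nth_index None c0_in) nth_uniq // index_mem.
  case: eqP => // _; rewrite /shift_of; case: o => [v|]; last by rewrite addr0.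
  (* The shift is linear, so it vanishes at the zero vector and leaves the entry 1. *)
  by rewrite /gauge_of /dist_of big1 // !addr0 oppr0 addr0.
- move=> k i i' kn ii'.
  have csi : nth None cs i = nth None cs' i' by rewrite nth_cs' ii'.
  rewrite !nth_cat !size_map /bump; case: (leqP (size V) k) => Vk.
    rewrite add1n ltnNge (leqW Vk) /= subSn //=.
    rewrite (nth_map 0) ?mxE; last by rewrite ltn_subLR // sB.
    rewrite /insert_coord csi -(coord_nth _ i') //; case: eqP => // c0i.
    by have := mem_nth None (ltn_ord i'); rewrite mem_cs' c0i eqxx.
  rewrite add0n Vk !(nth_map [::]) // !mxE /root_dist.
  (* Both basis vectors are the indicator function of the same name, so the gauge gradients have
     equal entries there. *)
  suff -> : coord (delta_mx 0 i : 'rV[R]_(size cs)) =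
            coord (delta_mx 0 i' : 'rV[R]_(size cs')) by [].
  by apply/funext => m; rewrite !coord_delta // csi.
Qed.

Let nbhs_positive_lengths (phi : lengths) :
  (forall f, 0 < phi f)%E -> finite_off b phi ->
  \forall psi \near phi, (forall f, 0 < psi f)%E /\ finite_off b psi.
Proof.
move=> phi0 fphi.
have ev f (A : set (\bar R)) : open A -> A (phi f) ->
    nbhs phi [set psi : lengths | A (psi f)].
  move=> oA Aphi; apply: (ptws_continuous_eval (i := f)).
  exact: open_nbhs_nbhs.
have pos f : nbhs phi [set psi : lengths | 0 < psi f]%E.
  have op : open [set x : \bar R | (0 < x)%E] by exact: open_ereal_gt_ereal.
  exact: (ev f _ op (phi0 f)).
have fin f : nbhs phi [set psi : lengths | sval f != b -> psi f \is a fin_num].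
  have [fb|fb] := eqVneq (sval f) b.
    by apply: (@filterS _ _ _ setT) filterT => psi _ /= /eqP.
  (* For a positive value, being finite amounts to the open condition of lying below [+oo]. *)
  have phioo : (phi f < +oo)%E by rewrite ltey_eq fphi.
  have op : open [set x : \bar R | (x < +oo)%E] by exact: open_ereal_lt_ereal.
  apply: (@filterS _ _ _ _ _ _ (filterI (pos f) (ev f _ op phioo))).
  by move=> psi [psi0 psioo] _; rewrite gt0_fin_numE.
have Fpos := @filter_forall_sig _ E lengths (nbhs phi)
  (fun f => [set psi : lengths | 0 < psi f]%E) (nbhs_filter phi) pos.
have Ffin := @filter_forall_sig _ E lengths (nbhs phi)
  (fun f => [set psi : lengths | sval f != b -> psi f \is a fin_num])
  (nbhs_filter phi) fin.
exact: (@filterI lengths (nbhs phi) (nbhs_filter phi) _ _ Fpos Ffin).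
Qed.

Let extended_lengths_pos s z f : (0 < s)%E -> PS (coord z) ->
  (0 < extended_lengths s z f)%E.
Proof.
move=> s0 /PS_lengths[_ pos]; rewrite /extended_lengths.
by case: eqP => // /eqP fb; rewrite lte_fin pos // (valP f).
Qed.

Lemma collar_boundary_sign :
  bears_boundary_sign iM iS ((-1) ^+ (index c0 cs + size V)).
Proof.
have [rho crho rhoE] := recover_map.
pose ib : {f | f \in E} := exist _ b bE.
have ext_b s z : extended_lengths s z ib = s by rewrite /extended_lengths eqxx.
have rho_ext s z : PS (coord z) -> rho (extended_lengths s z) = z.
  move=> /PS_lengths[onz _].
  by rewrite (rhoE _ _ onz (extended_lengths_off s z)) row_coord.
(* One global collar serves every [y]: all of [S], with every length [s > 0]. *)
move=> y _; exists setT, 0, insert_map; split; first exact: filterT.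
- split.
  + apply: (subspace_eq_continuous (f := fun sz => extended_lengths sz.1 sz.2)).
      by move=> [s z] /set_mem[/= s0 _ _]; exact: (esym (collarE z s0)).
    apply: continuous_subspaceT; exact: extended_lengths_continuous.
  + move=> [s z] [s' z'] /set_mem[/= s0 Sz _] /set_mem[/= s'0 Sz' _].
    rewrite !collarE // => eqe.
    congr (_, _); first by rewrite -(ext_b s z) eqe ext_b.
    by rewrite -(rho_ext s z) // eqe rho_ext.
  + move=> O oO.
    (* The inverse of the collar sends [phi] to [(phi ib, rho phi)]. Positivity and finiteness off
       [b] cut its domain out of the closure by open conditions. *)
    exists [set phi | [/\ (forall f, 0 < phi f)%E, finite_off b phi &
                          O (phi ib, rho phi)]].
      rewrite openE => phi [phi0 fphi Ophi].
      have ni : (psi ib, rho psi) @[psi --> phi] --> (phi ib, rho phi).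
        exact: (@cvg_pair lengths _ _ (nbhs phi) _ _ _ _ _ _ _
          (ptws_continuous_eval (i := ib) (x := phi)) (crho _ fphi)).
      have /ni nO : nbhs (phi ib, rho phi) O by exact: open_nbhs_nbhs.
      apply: (@filterS2 _ _ (nbhs_filter phi) _ _ _ _
        (nbhs_positive_lengths phi0 fphi) nO).
      by move=> psi [].
    rewrite eqEsubset; split=> [_ [[s z] [[/= s0 Sz _] Osz] <-]|phi].
      rewrite collarE //; split; first exact: extended_lengths_closure.
      split=> [f||]; first exact: extended_lengths_pos.
        by move=> f /negPf fb; rewrite /extended_lengths fb.
      by rewrite ext_b rho_ext.
    move=> [clphi [phi0 fphi Ophi]].
    have [onphi offphi] := closure_lengths rhoE (crho _ fphi) fphi clphi.
    have phiE : extended_lengths (phi ib) (rho phi) = phi.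
      apply/funext => f; rewrite /extended_lengths; case: (eqVneq (sval f) b).
        by move=> fb; congr (phi _); exact: val_inj.
      by move=> fb; rewrite offphi.
    have Sphi : PS (coord (rho phi)).
      apply/PS_lengths; split=> // f fE fb.
      by rewrite -lte_fin -(offphi (exist _ f fE) fb).
    exists (phi ib, rho phi); last by rewrite collarE.
    by split=> //; split=> //; exact: phi0.
- move=> s z [/= s0 Sz _]; rewrite lte_fin in s0; split.
  + by rewrite /= coord_insert_map; exact: PM_insert.
  + exact: linear_differentiable insert_map_continuous.
  + move=> B [tB sB dB] /=.
    (* A continuous linear map is its own differential, so the outward vector is
       [insert_map (1, 0)]. *)
    have dE := diff_lin (s, z) insert_map_continuous.
    have -> : 'd insert_map (s, z) = insert_map :> (_ -> _) by exact: dE.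
    have sgE : det_rows (oc_coor M ++ insert_map (1, 0) ::
        [seq insert_map (0, y) | y <- B]) = _ := det_insert sB.
    split; last by rewrite /basis_sign sgE sgrM sgrX sgrN1.
    split; first exact: insert_map_tangent.
      by move: sB; rewrite !size_cat /= !size_map addnS => ->.
    by rewrite sgE mulf_neq0 // signr_eq0.
Qed.

End Collar.

(** * Addresses in ribbon trees *)

(** Induction through the nested list of children. Indices past its end designate the default
    [RLeaf], covered by the leaf case. *)
Lemma rtree_nth_ind (P : rtree -> Prop) : P RLeaf ->
  (forall s, (forall k, P (nth RLeaf s k)) -> P (RNode s)) -> forall t, P t.
Proof.
move=> Pleaf Pnode; fix IHt 1 => -[//|s]; apply: Pnode.
elim: s => [|t s IHs] [|k]; [exact: Pleaf|exact: Pleaf|exact: IHt|exact: IHs].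
Qed.

Lemma mem_graft_addrs ss k v :
  (k :: v \in graft_addrs ss) = (k < size ss)%N && (v \in nth [::] ss k).
Proof.
apply/allpairsPdep/andP => [[k' [v' [+ + [-> ->]]]]|[ks vs]].
  by rewrite mem_iota.
by exists k, v; rewrite mem_iota.
Qed.

Lemma nil_graft_addrs ss : [::] \notin graft_addrs ss.
Proof. by apply/allpairsPdep => -[k [v []]]. Qed.

Lemma mem_vertices_cons s k v :
  (k :: v \in vertices (RNode s)) = (v \in vertices (nth RLeaf s k)).
Proof.
rewrite inE /= mem_graft_addrs size_map; case: ltnP => ks /=.
  by rewrite (nth_map RLeaf).
by rewrite nth_default.
Qed.

Lemma mem_leaves_cons s k v :
  (k :: v \in leaves (RNode s)) =
  (k < size s)%N && (v \in leaves (nth RLeaf s k)).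
Proof.
rewrite /= mem_graft_addrs size_map; case: ltnP => // ks.
by rewrite (nth_map RLeaf).
Qed.

Lemma vertices_rcons t v k : rcons v k \in vertices t -> v \in vertices t.
Proof.
by elim: v t => [|i v IHv] [|s] //=; rewrite !mem_vertices_cons; exact: IHv.
Qed.

Lemma leaves_rcons t v k : rcons v k \in leaves t -> v \in vertices t.
Proof.
elim: v t => [|i v IHv] [|s] //=; rewrite mem_vertices_cons.
by rewrite mem_leaves_cons => /andP[_ /IHv].
Qed.

Lemma leaves_vertices t v : v \in leaves t -> v \notin vertices t.
Proof.
elim: v t => [|i v IHv] [|s] //=; first by rewrite (negPf (nil_graft_addrs _)).
by rewrite mem_leaves_cons mem_vertices_cons => /andP[_ /IHv].
Qed.

Lemma nil_vertices_leaves t : [::] \in vertices t -> [::] \notin leaves t.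
Proof. by case: t => // s _; exact: nil_graft_addrs. Qed.

(** Stability enters through this fact: every vertex has a leftmost child edge, so one can always
    climb from a vertex. *)
Lemma stable_child0 t v : stable t -> v \in vertices t ->
  (rcons v 0%N \in vertices t) || (rcons v 0%N \in leaves t).
Proof.
elim: v t => [|i v IHv] [|s] // /andP[s1 st].
  move=> _; rewrite mem_vertices_cons mem_leaves_cons (ltnW s1) /=.
  by case: (nth RLeaf s 0).
rewrite rcons_cons !mem_vertices_cons mem_leaves_cons; case: (ltnP i (size s)) => si.
  by apply: IHv; exact: (all_nthP RLeaf st).
by rewrite nth_default.
Qed.

Lemma graft_addrs_uniq ss :
  (forall k, uniq (nth [::] ss k)) -> uniq (graft_addrs ss).
Proof.
move=> uss; apply: allpairs_uniq_dep => [|k _|]; rewrite ?iota_uniq //.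
by move=> [k v] [k' v'] _ _ /= [-> ->].
Qed.

Lemma vertices_uniq t : uniq (vertices t).
Proof.
elim/rtree_nth_ind: t => // s IHs; rewrite /= nil_graft_addrs graft_addrs_uniq // => k.
case: (ltnP k (size s)) => ks; first by rewrite (nth_map RLeaf).
by rewrite nth_default ?size_map.
Qed.

(** Stated for lists, because the left-to-right order of the vertices on the gauge determines the
    coorientation. *)
Lemma vertices_prune t a : a \in vertices t ->
  vertices (prune t a) = [seq v <- vertices t | ~~ prefix a v].
Proof.
elim: a t => [|i a IHa] t.
  case: t => // s _; apply/esym/eqP; rewrite -[_ == _]negbK -has_filter.
  by apply/hasPn => v _; rewrite prefix0s.
case: t => // s; rewrite mem_vertices_cons => sa /=.
have si : (i < size s)%N.
  by rewrite ltnNge; apply/negP => si; rewrite nth_default in sa.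
congr (_ :: _); rewrite /graft_addrs filter_flatten -map_comp !size_map size_set_nth.
rewrite (maxn_idPr si); congr flatten; apply/eq_in_map => k.
rewrite mem_iota /= => ks; rewrite filter_map.
rewrite !(nth_map RLeaf) ?size_set_nth ?(maxn_idPr si) // nth_set_nth /=.
case: (eqVneq k i) => [->|ki].
  by rewrite IHa //; congr map; apply: eq_filter => v /=; rewrite eqxx.
congr map; rewrite -[LHS]filter_predT; apply: eq_filter => v /=.
by rewrite eq_sym (negPf ki).
Qed.

Lemma vertices_subtree_above t a v : a \in vertices t ->
  (v \in vertices (subtree_above t a)) = (a ++ v \in vertices t).
Proof.
elim: a t => [|i a IHa] t; first by case: t.
by case: t => // s; rewrite /= !mem_vertices_cons; exact: IHa.
Qed.

Lemma mem_internal_edges t e :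
  (e \in internal_edges t) = (e != [::]) && (e \in vertices t).
Proof. by rewrite mem_filter. Qed.

(** Addresses not extending [a] stay in the pruned piece, and proper extensions are edges of the
    piece above. The address [a] itself is a leaf of the former and the root of the latter, hence
    internal in neither. *)
Lemma mem_broken_edges t a e : a \in vertices t ->
  (e \in broken_edges t a) = (e != a) && (e \in internal_edges t).
Proof.
move=> ta; rewrite mem_cat !mem_internal_edges vertices_prune // mem_filter.
case: (boolP (prefix a e)) => [/prefixP[v ->]|ae] /=.
  rewrite andbF /= mem_map => [|v1 v2 /eqP]; last by rewrite eqseq_cat // eqxx => /eqP.
  rewrite mem_internal_edges vertices_subtree_above //.
  have -> : (a ++ v == a) = (v == [::]) by rewrite -{2}[a]cats0 eqseq_cat ?eqxx.
  rewrite -!size_eq0 size_cat addn_eq0 negb_and.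
  by case: (size v == 0%N); rewrite ?orbT.
rewrite (_ : e \in map _ _ = false) ?orbF; last first.
  by apply: contraNF ae => /mapP[v _ ->]; exact: prefix_prefix.
by have [ea|//] := eqVneq e a; rewrite ea prefix_refl in ae.
Qed.

Lemma parent_rcons v k : parent (rcons v k) = v.
Proof. by rewrite /parent size_rcons /= -cats1 take_size_cat. Qed.

(** Descending induction along leftmost paths, which terminates because no vertex is deeper than the
    maximum [h]. *)
Lemma vertices_child0_ind t (P : addr -> Prop) :
  (forall v, v \in vertices t ->
     (rcons v 0%N \in vertices t -> P (rcons v 0%N)) -> P v) ->
  forall v, v \in vertices t -> P v.
Proof.
move=> IH v tv; pose h := \max_(u <- vertices t) size u.
have hP u : u \in vertices t -> (size u <= h)%N.
  by move=> tu; rewrite /h; exact: leq_bigmax_seq.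
have [n] := ubnP (h - size v); elim: n => // n IHn in v tv *.
move=> vn; apply: IH => // tv0; apply: IHn => //.
by have := hP _ tv0; rewrite size_rcons; lia.
Qed.

(** * Breaking above the gauge *)

Lemma dist_of_rcons (R : realType) (c : option addr -> R) v k :
  dist_of c (rcons v k) = dist_of c v + c (Some (rcons v k)).
Proof.
rewrite /dist_of size_rcons big_ord_recr /= -(size_rcons v k) take_size.
congr (_ + _); apply: eq_bigr => i _; rewrite -cats1 takel_cat //.
Qed.

Lemma prefix_parent a v : prefix a v -> v != a -> prefix a (parent v).
Proof.
case: (lastP v) => [|u k]; first by rewrite prefixs0 eq_sym => ->.
move=> /prefixP[s]; case: (lastP s) => [|s' k'].
  by rewrite cats0 => <-; rewrite eqxx.
by rewrite -rcons_cat => /rcons_inj[-> _] _; rewrite parent_rcons prefix_prefix.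
Qed.

Section AboveBreak.
Variables (R : realType) (t : rtree) (g : addr -> gauge_pos) (a : addr).
Hypotheses (t_stable : stable t) (g_gauge : is_gauge t g).
Implicit Types (c : option addr -> R) (v e : addr).

Let tc := tc_edges t g.
Let V := on_vertices t g.

Lemma mem_tc_edges e q : ((e, q) \in tc) =
  match q with
  | Whole => ~~ crosses t g e && (e \in internal_edges t)
  | LowerPart => crosses t g e && (e \in internal_edges t ++ leaves t)
  | UpperPart => crosses t g e && (e \in vertices t)
  end.
Proof.
have map_part q' (s : seq addr) :
    ((e, q) \in [seq (e', q') | e' <- s]) = (q == q') && (e \in s).
  apply/mapP/andP => [[e' se' [-> ->]]//|[/eqP-> se]]; by exists e.
rewrite !mem_cat !map_part !mem_filter {map_part}.
by case: q => /=; rewrite ?orbF ?mem_cat ?mem_filter.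
Qed.

Definition positive_lengths c := forall f, f \in tc -> 0 < length_of c f.

Definition unbroken_ineqs c :=
  (forall e, e \in internal_edges t -> 0 < c (Some e)) /\
  (forall v, v \in vertices t -> gauge_ineq (g v) (- c None) (dist_of c v)).

Definition broken_ineqs c :=
  (forall e, e \in broken_edges t a -> 0 < c (Some e)) /\
  (forall v, v \in vertices (prune t a) ->
     gauge_ineq (g v) (- c None) (dist_of c v)).

Lemma crosses_child v k : g v = Below -> upper_pos t g (rcons v k) = Above ->
  crosses t g (rcons v k).
Proof.
move=> gv up; rewrite /crosses /lower_pos up.
by rewrite -size_eq0 size_rcons parent_rcons gv.
Qed.

(** On a crossed edge the two parts telescope to the difference of the distances of its ends. *)
Lemma length_of_internal c e : e \in internal_edges t ->
  c (Some e) =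
    if crosses t g e
    then length_of c (e, LowerPart) + length_of c (e, UpperPart)
    else length_of c (e, Whole).
Proof.
rewrite mem_internal_edges => /andP[e0 _]; case: ifP => // _.
case: (lastP e) e0 => // v k _.
by rewrite /length_of /= parent_rcons dist_of_rcons; ring.
Qed.

Lemma internal_edge_gt0 c e : positive_lengths c -> e \in internal_edges t ->
  0 < c (Some e).
Proof.
move=> pos te; rewrite (length_of_internal c te).
move: (te); rewrite mem_internal_edges => /andP[_ tv].
case: ifPn => cr; last by apply: pos; rewrite mem_tc_edges cr te.
by apply: addr_gt0; apply: pos; rewrite mem_tc_edges cr ?mem_cat ?te.
Qed.

Lemma rcons_internal v k :
  rcons v k \in vertices t -> rcons v k \in internal_edges t.
Proof. by rewrite mem_internal_edges -size_eq0 size_rcons. Qed.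

(** Each inequality at a vertex is obtained by walking to a coloured vertex, at height [- c None],
    and adding up the positive lengths met on the way. *)
Lemma unbroken_ineqs_of_lengths c : on_gauge V c -> positive_lengths c ->
  unbroken_ineqs c.
Proof.
move=> onc pos; split=> [e te|]; first exact: internal_edge_gt0.
(* From a vertex below the gauge, climb along leftmost children until a vertex on the gauge or a
   crossed edge, possibly an incoming one. *)
have below v : v \in vertices t -> g v = Below -> dist_of c v < - c None.
  move: v; apply: vertices_child0_ind => v tv IHv gv.
  case/orP: (stable_child0 t_stable tv) => [tv0|lv0].
    have lv0 := internal_edge_gt0 pos (rcons_internal tv0).
    case gv0: (g (rcons v 0)).
    - by have := IHv tv0 gv0; rewrite dist_of_rcons; lra.
    - have := onc (rcons v 0); rewrite mem_filter tv0 gv0 => /(_ isT).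
      by rewrite /gauge_of dist_of_rcons; lra.
    - have cr : crosses t g (rcons v 0).
        by apply: crosses_child => //; rewrite /upper_pos tv0.
      have := pos (rcons v 0, LowerPart); rewrite mem_tc_edges cr mem_cat.
      rewrite rcons_internal // => /(_ isT).
      by rewrite /length_of /= parent_rcons; lra.
  have cr : crosses t g (rcons v 0).
    by apply: crosses_child => //; rewrite /upper_pos (negPf (leaves_vertices lv0)).
  have := pos (rcons v 0, LowerPart); rewrite mem_tc_edges cr mem_cat lv0 orbT.
  by move=> /(_ isT); rewrite /length_of /= parent_rcons; lra.
(* From a vertex above the gauge, go down towards the root. If the root itself is above, the walk
   ends on the crossed outgoing edge. *)
have above v : v \in vertices t -> g v = Above -> - c None < dist_of c v.
  have upper u : u \in vertices t -> crosses t g u -> - c None < dist_of c u.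
    move=> tu cr; have := pos (u, UpperPart); rewrite mem_tc_edges cr tu => /(_ isT).
    by rewrite /length_of /=; lra.
  elim/last_ind: v => [|v k IHv] tv gv.
    by apply: upper => //; rewrite /crosses /lower_pos /upper_pos tv gv.
  have lv := internal_edge_gt0 pos (rcons_internal tv).
  have tv' := vertices_rcons tv.
  case gv': (g v).
  - by apply: upper => //; apply: crosses_child => //; rewrite /upper_pos tv.
  - have := onc v; rewrite mem_filter tv' gv' => /(_ isT).
    by rewrite dist_of_rcons /gauge_of; lra.
  - by have := IHv tv' gv'; rewrite dist_of_rcons; lra.
move=> v tv; case gv: (g v) => /=; [exact: below| |exact: above].
have := onc v; rewrite mem_filter tv gv => /(_ isT).
by rewrite /gauge_of; lra.
Qed.

Lemma unbroken_ineqs_on c : unbroken_ineqs c -> on_gauge V c.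
Proof.
move=> [_ ineq] v; rewrite mem_filter => /andP[/eqP gv /ineq].
by rewrite gv /gauge_of /=; lra.
Qed.

(** Provides a point at which lambda can be read. When the root is below the gauge, the leftmost
    path from it must meet the gauge. *)
Lemma coloured_vertex_exists : [::] \in vertices t ->
  [\/ crosses t g [::], exists v, v \in V |
      exists2 e, e \in internal_edges t ++ leaves t & crosses t g e].
Proof.
move=> t0.
have below v : v \in vertices t -> g v = Below ->
    (exists v, v \in V) \/
    exists2 e, e \in internal_edges t ++ leaves t & crosses t g e.
  move: v; apply: vertices_child0_ind => v tv IHv gv.
  case/orP: (stable_child0 t_stable tv) => [tv0|lv0].
    case gv0: (g (rcons v 0)); first exact: IHv.
    - by left; exists (rcons v 0); rewrite mem_filter gv0 tv0.
    - right; exists (rcons v 0); first by rewrite mem_cat rcons_internal.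
      by apply: crosses_child => //; rewrite /upper_pos tv0.
  right; exists (rcons v 0); first by rewrite mem_cat lv0 orbT.
  by apply: crosses_child => //; rewrite /upper_pos (negPf (leaves_vertices lv0)).
case g0: (g [::]).
- by case: (below _ t0 g0) => ?; [constructor 2|constructor 3].
- by constructor 2; exists [::]; rewrite mem_filter g0.
- by constructor 1; rewrite /crosses /upper_pos t0 g0.
Qed.

Hypotheses (ta : a \in vertices t) (ga : g a = Above).

(** For the outgoing edge the broken coordinate is lambda, which is already the length of the upper
    part. A shift [o] occurs only when an internal edge is crossed, since its coordinate also
    includes the lower part. *)
Let c0 : option addr := if a == [::] then None else Some a.
Let b := above_break_part t g a.
Let o := if (a != [::]) && crosses t g a then Some (parent a) else None.
Local Notation agree c c' := (forall m, m != c0 -> c m = c' m).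

(** By the gauge condition a vertex whose parent is above the gauge is itself above, so this
    propagates from [a] upwards. *)
Lemma above_descendant v : v \in vertices t -> prefix a v -> g v = Above.
Proof.
elim/last_ind: v => [|v k IHv] tv av.
  by move: av; rewrite prefixs0 => /eqP <-.
have [-> //|va] := eqVneq (rcons v k) a.
have gv : g v = Above.
  by apply: IHv (vertices_rcons tv) _; rewrite -(parent_rcons v k) prefix_parent.
have := g_gauge tv; rewrite parent_rcons gv -size_eq0 size_rcons /=.
by case: (g (rcons v k)) => // /(_ isT isT).
Qed.

Lemma root_vertex : [::] \in vertices t.
Proof. by case: t ta. Qed.

Lemma not_prefix_neq_nil v : ~~ prefix a v -> a != [::].
Proof. by apply: contraNneq => ->; rewrite prefix0s. Qed.

(** Any address not above [a] shows that [a] is not the root, so the broken coordinate is not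
    lambda. *)
Lemma agree_lambda c c' v : agree c c' -> ~~ prefix a v -> c None = c' None.
Proof.
by move=> cc' /not_prefix_neq_nil av; apply: cc'; rewrite /c0 (negPf av).
Qed.

Lemma agree_edge c c' e : agree c c' -> e != a -> c (Some e) = c' (Some e).
Proof.
by move=> cc' ea; apply: cc'; rewrite /c0; case: ifP.
Qed.

Lemma take_not_prefix k v : ~~ prefix a v -> take k v != a.
Proof. by apply: contraNneq => <-; exact: prefix_take. Qed.

Lemma agree_dist c c' v :
  agree c c' -> ~~ prefix a v -> dist_of c v = dist_of c' v.
Proof.
move=> cc' av; apply: eq_dist_of => k _; apply: agree_edge => //.
exact: take_not_prefix.
Qed.

Lemma below_not_prefix v : v \in vertices t -> g v != Above -> ~~ prefix a v.
Proof. by move=> tv; apply: contraNN => /(above_descendant tv) ->. Qed.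

Lemma crosses_parent e : e \in internal_edges t ++ leaves t -> crosses t g e ->
  parent e \in vertices t /\ g (parent e) = Below.
Proof.
move=> te /andP[/eqP lo _]; move: te lo; rewrite /lower_pos mem_cat mem_internal_edges.
case: (lastP e) => [|v k].
  by rewrite /= (negPf (nil_vertices_leaves _)) // root_vertex.
rewrite -size_eq0 size_rcons /= parent_rcons => /orP[] tv gv; split=> //.
  exact: vertices_rcons tv.
exact: leaves_rcons tv.
Qed.

Lemma crosses_not_prefix e : e \in vertices t -> crosses t g e -> e != a ->
  ~~ prefix a e.
Proof.
move=> te /andP[/eqP lo _] ea; apply/negP => ae.
have e0 : e != [::].
  by apply: contraNneq ea => e0; move: ae; rewrite e0 prefixs0 eq_sym.
have := prefix_parent ae ea; move: te lo e0; rewrite /lower_pos.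
case: (lastP e) => // v k tv; rewrite -size_eq0 size_rcons /= parent_rcons => gv _.
by apply/negP; apply: below_not_prefix (vertices_rcons tv) _; rewrite gv.
Qed.

(** A whole edge involves only its own coordinate. A part of a crossed edge involves lambda and a
    path that avoids [a], as everything above [a] is above the gauge. *)
Lemma length_of_local c c' f : agree c c' -> f \in tc -> f != b ->
  length_of c f = length_of c' f.
Proof.
case: f => e q cc'; rewrite mem_tc_edges /b /above_break_part /length_of /=.
case: q => /=.
- move=> /andP[ncr _] eb; apply: agree_edge => //; apply: contraNneq eb => ea.
  by rewrite -ea (negPf ncr).
- move=> /andP[cr te] _; have [tp gp] := crosses_parent te cr.
  have np : ~~ prefix a (parent e) by apply: below_not_prefix; rewrite ?gp.
  by rewrite (agree_lambda cc' np) (agree_dist cc' np).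
- move=> /andP[cr te] eb; have ea : e != a.
    by apply: contraNneq eb => ea; rewrite -ea cr.
  have np := crosses_not_prefix te cr ea.
  by rewrite (agree_lambda cc' np) (agree_dist cc' np).
Qed.

Lemma length_of_insert (s : R) c : length_of (insert_coord c0 o s c) b = s.
Proof.
rewrite /b /above_break_part /length_of /= /insert_coord /shift_of /o /c0.
have [a0|a0] := eqVneq a [::].
  have -> : crosses t g a by rewrite /crosses /lower_pos /upper_pos ta ga a0.
  by rewrite /= a0 /dist_of big_ord0 sub0r opprK addr0.
case: ifP => cr /=; last by rewrite eqxx addr0.
have np : ~~ prefix a (parent a).
  apply/negP => /size_prefix; rewrite /parent size_takel ?leq_pred //.
  by move: a0; rewrite -size_eq0; case: (size a) => //= m _; rewrite ltnn.
(* The path to [parent a] does not see the insertion, so its distance cancels against the shift and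
   [s] remains. *)
pose c' := insert_coord c0 (Some (parent a)) s c.
have cc' : agree c' c by move=> m /negPf mc0; rewrite /c' /insert_coord mc0.
have -> : (fun m => if m == Some a then s + - gauge_of c (parent a) else c m) = c'.
  by rewrite /c' /insert_coord /c0 (negPf a0).
have -> : dist_of c' a = dist_of c (parent a) + c' (Some a).
  rewrite -(agree_dist cc' np); move: (c'); case: (lastP a) a0 => // v k _ c''.
  by rewrite dist_of_rcons parent_rcons.
rewrite {1}/c' /insert_coord /c0 (negPf a0) eqxx /shift_of /gauge_of.
by ring.
Qed.

Lemma gauge_of_local c c' v :
  agree c c' -> v \in V -> gauge_of c v = gauge_of c' v.
Proof.
move=> cc'; rewrite mem_filter => /andP[/eqP gv tv].
have np : ~~ prefix a v by apply: below_not_prefix; rewrite ?gv.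
by rewrite /gauge_of (agree_lambda cc' np) (agree_dist cc' np).
Qed.

Let insert_agree (s : R) c : agree (insert_coord c0 o s c) c.
Proof. by move=> m /negPf mc0; rewrite /insert_coord mc0. Qed.

Lemma mem_vertices_prune v :
  (v \in vertices (prune t a)) = ~~ prefix a v && (v \in vertices t).
Proof. by rewrite vertices_prune // mem_filter. Qed.

(** The removed vertices are all above the gauge; hence both cells are cooriented by the same
    ordered list of vertices. *)
Lemma on_vertices_prune : on_vertices (prune t a) g = V.
Proof.
rewrite /V /on_vertices vertices_prune // -filter_predI; apply: eq_in_filter => v tv.
rewrite /=; case: eqP => //= gv.
by apply: below_not_prefix; rewrite ?gv.
Qed.

Lemma broken_ineqsP c : broken_ineqs c <->
  on_gauge V c /\ (forall f, f \in tc -> f != b -> 0 < length_of c f).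
Proof.
split=> [[posE ineq]|[onc pos]].
  split=> [v|[e q] + eb].
    rewrite -on_vertices_prune mem_filter => /andP[/eqP gv /ineq].
    by rewrite gv /gauge_of /=; lra.
  rewrite mem_tc_edges /length_of /=; case: q eb => /= eb.
  - move=> /andP[ncr te]; apply: posE; rewrite mem_broken_edges // te andbT.
    by apply: contraNneq eb => ea; rewrite /b /above_break_part -ea (negPf ncr).
  - move=> /andP[cr te]; have [tp gp] := crosses_parent te cr.
    have /ineq : parent e \in vertices (prune t a).
      by rewrite mem_vertices_prune tp below_not_prefix ?gp.
    by rewrite gp /=; lra.
  - move=> /andP[cr te]; have ea : e != a.
      by apply: contraNneq eb => ea; rewrite /b /above_break_part -ea cr.
    have /ineq : e \in vertices (prune t a).
      by rewrite mem_vertices_prune te crosses_not_prefix.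
    have /andP[_ /eqP] := cr; rewrite /upper_pos te => ->.
    by rewrite /=; lra.
(* Giving the broken part the length 1, or any positive one, yields a point of the unbroken cell;
   its inequalities away from [a] are those of the broken cell. *)
have [|f tf|posE ineq] := @unbroken_ineqs_of_lengths (insert_coord c0 o 1 c).
- by move=> v vV; rewrite (gauge_of_local (insert_agree 1 c)) // onc.
- have [->|fb] := eqVneq f b; first by rewrite length_of_insert.
  by rewrite (length_of_local (insert_agree 1 c)) // pos.
split=> [e|v].
  rewrite mem_broken_edges // => /andP[ea /posE].
  by rewrite (agree_edge (insert_agree 1 c) ea).
rewrite mem_vertices_prune => /andP[np /ineq].
by rewrite (agree_lambda (insert_agree 1 c) np) (agree_dist (insert_agree 1 c) np).
Qed.

Lemma recoverable_edge e : e \in internal_edges t -> e != a ->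
  recoverable tc b V (fun c => c (Some e)).
Proof.
move=> te ea; apply: (eq_recoverable (fun c _ => esym (length_of_internal c te))).
have eb q : (e, q) != b by apply: contraNneq ea => -[->].
move: (te); rewrite mem_internal_edges => /andP[_ tv].
case: (boolP (crosses t g e)) => cr; last first.
  by apply: recoverable_length => //; rewrite mem_tc_edges cr te.
by apply: recoverableD; apply: recoverable_length => //;
  rewrite mem_tc_edges cr ?mem_cat ?te.
Qed.

Lemma take_vertex v k : v \in vertices t -> take k v \in vertices t.
Proof.
elim/last_ind: v => // v i IHv tv; case: (ltnP (size v) k) => vk.
  by rewrite take_oversize ?size_rcons.
by rewrite -cats1 takel_cat //; exact: IHv (vertices_rcons tv).
Qed.

Lemma recoverable_dist_vertex v : v \in vertices t -> ~~ prefix a v ->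
  recoverable tc b V (fun c => dist_of c v).
Proof.
move=> tv np; apply: recoverable_dist => k kv; apply: recoverable_edge.
  rewrite mem_internal_edges take_vertex // andbT -size_eq0 size_takel //.
exact: take_not_prefix.
Qed.

(** The height [- c None] is the distance from the root to any coloured vertex: minus the upper part
    of the outgoing edge, the distance of a vertex on the gauge, or that of the lower end of a
    crossed edge plus its lower part. *)
Lemma recoverable_lambda : a != [::] -> recoverable tc b V (fun c => c None).
Proof.
move=> a0; case: (coloured_vertex_exists root_vertex) => [cr|[v vV]|[e te cr]].
- have rl : recoverable tc b V (fun c => length_of c ([::], UpperPart)).
    apply: recoverable_length; first by rewrite mem_tc_edges cr root_vertex.
    by apply: contraNneq a0 => -[<-].
  apply: eq_recoverable rl => c _.
  by rewrite /length_of /= /dist_of big_ord0 sub0r opprK.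
- move: (vV); rewrite mem_filter => /andP[/eqP gv tv].
  have np : ~~ prefix a v by apply: below_not_prefix; rewrite ?gv.
  apply: eq_recoverable (recoverableN (recoverable_dist_vertex tv np)) => c onc.
  by have := onc v vV; rewrite /gauge_of; lra.
- have [tp gp] := crosses_parent te cr.
  have np : ~~ prefix a (parent e) by apply: below_not_prefix; rewrite ?gp.
  have rl : recoverable tc b V (fun c => length_of c (e, LowerPart)).
    apply: recoverable_length; first by rewrite mem_tc_edges cr te.
    by rewrite /b /above_break_part; case: ifP => _; apply/eqP => -[].
  apply: eq_recoverable
    (recoverableN (recoverableD rl (recoverable_dist_vertex tp np))) => c _.
  by rewrite /length_of /=; ring.
Qed.

(** * Coordinate lists ordered by the orientation *)

Variable w : seq addr.
Hypothesis tw : is_orientation t w.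

Let mem_w e : (e \in w) = (e \in internal_edges t).
Proof. exact: perm_mem tw e. Qed.

Let w_uniq : uniq w.
Proof. by rewrite (perm_uniq tw) filter_uniq // vertices_uniq. Qed.

Let coords_t : coords t w = None :: map Some w.
Proof. by case: t ta. Qed.

Lemma coords_uniq : uniq (coords t w).
Proof.
rewrite coords_t /= map_inj_uniq ?w_uniq ?andbT; last by move=> ? ? [].
by apply/mapP => -[].
Qed.

Lemma broken_coord_in : c0 \in coords t w.
Proof.
rewrite coords_t inE /c0; have [//|a0] := eqVneq a [::].
by rewrite mem_map ?mem_w ?mem_internal_edges ?a0 ?ta //; move=> ? ? [].
Qed.

Lemma coords_prune : coords (prune t a) (rem a w) = rem c0 (coords t w).
Proof.
rewrite coords_t /c0; have [a0|a0] := eqVneq a [::].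
  by rewrite a0 /= rem_id // mem_w mem_internal_edges.
have -> : coords (prune t a) (rem a w) = None :: map Some (rem a w).
  by case: t ta => // s; case: a a0.
by rewrite /= !rem_filter ?map_inj_uniq // ?filter_map //; move=> ? ? [].
Qed.

Lemma above_break_in : b \in tc.
Proof.
rewrite /b /above_break_part.
case: (boolP (crosses t g a)) => cr; rewrite mem_tc_edges cr //=.
rewrite mem_internal_edges ta andbT; apply: contraNneq cr => a0.
by rewrite /crosses /lower_pos /upper_pos ta ga a0.
Qed.

Lemma recoverable_coord m : m \in coords (prune t a) (rem a w) ->
  recoverable tc b V (fun c => c m).
Proof.
rewrite coords_prune mem_rem_uniq ?coords_uniq // => /andP[]; rewrite coords_t.
rewrite !inE; case: m => [e|] /=.
  rewrite mem_map; last by move=> ? ? [].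
  rewrite mem_w => ec te; apply: recoverable_edge => //; apply: contraNneq ec => ea.
  rewrite /c0 ea; have [a0|//] := eqVneq a [::].
  by move: te; rewrite mem_internal_edges ea a0.
by rewrite /c0; case: (eqVneq a [::]) => // a0 _ _; exact: recoverable_lambda.
Qed.

Lemma above_break_sign :
  bears_boundary_sign (CT_emb R t g w) (CT_broken_emb R t g a (rem a w))
    ((-1) ^+ (index c0 (coords t w) + size V)).
Proof.
have := @collar_boundary_sign R (coords t w) (coords (prune t a) (rem a w)) c0
  coords_uniq broken_coord_in coords_prune o tc b above_break_in V
  unbroken_ineqs broken_ineqs length_of_local length_of_insert gauge_of_local
  unbroken_ineqs_on unbroken_ineqs_of_lengths broken_ineqsP recoverable_coord.
(* The broken stratum is cooriented through the pruned tree, whereas the collar result uses [V] for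
   both cells. *)
rewrite -{2}on_vertices_prune.
exact.
Qed.

End AboveBreak.

(** If the upper end were not above the gauge, the lower end would be below it; then the edge would
    neither lie above the gauge nor cross it. *)
Lemma above_gauge_or_crossing t g e : is_gauge t g -> e \in internal_edges t ->
  edge_above_gauge g e || crosses t g e -> g e = Above.
Proof.
move=> g_gauge; rewrite mem_internal_edges => /andP[e0 te].
have := g_gauge e te e0; rewrite /edge_above_gauge /crosses /lower_pos /upper_pos.
rewrite (negPf e0) te; case: (g e) => // /(_ isT) -> //.
Qed.

(** Since lambda occupies position 0, the edge [e_p] sits at position [p], and the case [p = 0] fits
    the same count. *)
Lemma index_broken_coord t w p : [::] \in vertices t -> uniq w ->
  [::] \notin w -> (p <= size w)%N -> let a := nth_edge w p in
  index (if a == [::] then None else Some a) (coords t w) = p.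
Proof.
move=> t0 w_uniq w0 pw; have -> : coords t w = None :: map Some w by case: t t0.
case: p pw => [|p] pw //=; rewrite /nth_edge /=.
have -> : (nth [::] w p == [::]) = false.
  by apply: contraNF w0 => /eqP <-; exact: mem_nth.
by rewrite index_map ?index_uniq //; move=> ? ? [].
Qed.

Theorem proposition11 (R : realType) (n : nat) (t : rtree)
    (g : addr -> gauge_pos) (w : seq addr) (j p : nat) :
  (2 <= n)%N -> stable t -> arity t = n -> is_gauge t g ->
  size (on_vertices t g) = j ->
  is_orientation t w ->
  ([/\ (1 <= p)%N, (p <= size w)%N &
       edge_above_gauge g (nth_edge w p) || crosses t g (nth_edge w p)] \/
   p = 0%N /\ gauge_below_root t g) ->
  let e_p := nth_edge w p in
  bears_boundary_sign
    (CT_emb R t g w) (CT_broken_emb R t g e_p (rem e_p w))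
    ((-1) ^+ (p + j)).
Proof.
move=> n2 t_stable tn g_gauge <- tw hp e_p.
(* The single edge has arity 1, so arity at least 2 forces a root vertex. *)
have t0 : [::] \in vertices t by case: t tn {t_stable g_gauge tw hp} n2 => // <-.
have w_uniq : uniq w by rewrite (perm_uniq tw) filter_uniq // vertices_uniq.
have w0 : [::] \notin w by rewrite (perm_mem tw) mem_internal_edges.
have pw : (p <= size w)%N by case: hp => [[]|[->]].
have [te ge] : e_p \in vertices t /\ g e_p = Above.
  rewrite /e_p; case: hp => [[p1 _ he]|[-> below]]; last by split; last exact: below.
  have te : nth_edge w p \in internal_edges t.
    rewrite -(perm_mem tw) /nth_edge; case: (p) p1 pw => // k _ kw.
    exact: mem_nth.
  split; last exact: above_gauge_or_crossing te he.
  by move: te; rewrite mem_internal_edges => /andP[].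
rewrite -{1}(index_broken_coord t0 w_uniq w0 pw).
exact: above_break_sign.
Qed.
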